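(* Let $k$ be a field, let $k\mathcal{T}=\bigoplus_{n\ge 0}k\mathcal{T}_n$ be equipped with the product, unit, coproduct and counit of standard heap ordered trees, and let $k\mathfrak{S}=\bigoplus_{n\ge 0}k\mathfrak{S}_n$ be equipped with the heap product $\#$, its unit, the coproduct $\Delta$ and the counit $\epsilon$ (all defined in the context). Let $\varphi:k\mathcal{T}\to k\mathfrak{S}$ be the linear extension of the maps $\varphi:\mathcal{T}_n\to\mathfrak{S}_n$, $n\ge 0$, defined in the context. Then $\varphi$ is a bialgebra morphism; that is, $\varphi$ sends the unit to the unit, $\varphi(t_1t_2)=\varphi(t_1)\,\#\,\varphi(t_2)$ for all standard heap ordered trees $t_1,t_2$, $\Delta\circ\varphi=(\varphi\otimes\varphi)\circ\Delta$, and $\epsilon\circ\varphi=\epsilon$.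
   Context: **Trees.** A standard heap ordered tree on $n+1$ nodes is a finite rooted tree (no planar structure) in which all nodes except the root are labeled with $\{1,\dots,n\}$, each label occurring exactly once, and such that the labels of the children of a labeled node are all larger than the label of that node. $\mathcal{T}_n$ is the set of these trees; $k\mathcal{T}_n$ is the $k$-vector space with basis $\mathcal{T}_n$. $\mathcal{T}_0=\{e\}$, where $e$ is the tree consisting only of the root. A heap ordered tree is a finite rooted tree in which every node, including the root, carries a positive integer label, all labels being distinct, and such that each child has a larger label than its parent. The children of a node are listed from left to right in increasing order of label. ''Children of the root'' also refers to the subtrees rooted at those children. For a tree $t$ with distinct positive integer labels (root labeled or not) whose labels in increasing order are $j_1<\dots<j_k$, $\mathrm{st}(t,m)$ is the tree obtained by replacing each label $j_p$ by $p+m$; put $\mathrm{st}(t)=\mathrm{st}(t,0)$. $\mathrm{B}_-(t)$ is the set of subtrees left after deleting the (unlabeled) root of $t$. For a set $\{s_1,\dots,s_r\}$ of heap ordered trees and a tree $t_2$, $\mathrm{A}^+(\{s_1,\dots,s_r\},t_2)$ is the collection of all trees obtained from $t_2$ by making each $s_i$ a child of some node of $t_2$ (root included; different $s_i$ may go to the same node); if $t_2$ has $n+1$ nodes there are $(n+1)^r$ such trees. Product on $k\mathcal{T}$ (extended bilinearly): for $t_1\in\mathcal{T}_m$, $t_2\in\mathcal{T}_n$, $t_1t_2$ is the sum of the trees in $\mathrm{A}^+(\mathrm{B}_-(\mathrm{st}(t_1,n)),t_2)$. The unit is $e$. Coproduct: $\Delta(t)=\sum_{X\subseteq \mathrm{B}_-(t)}\mathrm{st}(\mathrm{A}^+(X,e))\otimes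 \mathrm{st}(\mathrm{A}^+(\mathrm{B}_-(t)\setminus X,e))$, where $\mathrm{A}^+(X,e)$ is the single tree whose unlabeled root has the elements of $X$ as children. Counit: $\epsilon(e)=1$ and $\epsilon(t)=0$ for every other tree $t$. It is known that this makes $k\mathcal{T}$ a Hopf algebra. **Permutations.** $\mathfrak{S}_n$ is the symmetric group on $\{1,\dots,n\}$ ($\mathfrak{S}_0$ has one element, the empty permutation); $k\mathfrak{S}_n$ is the $k$-vector space with basis $\mathfrak{S}_n$. Permutations are written as products of disjoint cycles, including all 1-cycles for fixed points; $(a_1a_2\cdots a_p)$ sends $a_1\mapsto a_2\mapsto\cdots\mapsto a_p\mapsto a_1$, and $a_1a_2\cdots a_p$ is the associated string. A product of disjoint cycles $(s_1)\cdots(s_r)$ is in standard order if each string $s_i$ begins with its smallest entry and the first entries of $s_1,s_2,\dots,s_r$ are decreasing. Every permutation can be written in standard order. Heap product (extended bilinearly): let $\sigma\in\mathfrak{S}_m$, $\tau\in\mathfrak{S}_n$. Replace $\sigma$ by the permutation of $\{n+1,\dots,n+m\}$ sending $n+i$ to $n+\sigma(i)$, and write it in standard order $(s_1)\cdots(s_r)$; write $\tau$ in standard order. There are $n+1$ attachment points: the entries $1,\dots,n$ appearing in the cycles of $\tau$, and one extra point $\circ$. For each choice of an attachment point for each of the $s_i$, form a permutation in $\mathfrak{S}_{m+n}$ as follows: if $s_i$ is assigned to an entry $a$ of $\tau$, the string $s_i$ is inserted directly to the right of $a$ in the cycle of $\tau$ containing $a$; if several strings are assigned to the same entry $a$, they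 are placed one after another directly to the right of $a$, from left to right in the order in which they occur in the standard order of $\sigma$; if $s_i$ is assigned to $\circ$, the cycle $(s_i)$ is included as a separate factor. Then $\sigma\,\#\,\tau$ is the sum of the resulting $(n+1)^r$ terms. The unit is the empty permutation in $\mathfrak{S}_0$. Coproduct: let $\pi\in\mathfrak{S}_n$ have set of disjoint cycles $C=\{(s_1),\dots,(s_k)\}$ (1-cycles included). For $X\subseteq C$, let $\rho(X)$ be the permutation in $\mathfrak{S}_{\ell}$ obtained from the product of the cycles in $X$ by replacing the $j$-th smallest of the $\ell$ entries occurring in $X$ by $j$, for each $j$. Then $\Delta(\pi)=\sum_{X\subseteq C}\rho(X)\otimes\rho(C\setminus X)$. Counit: $\epsilon(\pi)=1$ if $\pi\in\mathfrak{S}_0$, and $\epsilon(\pi)=0$ otherwise. **The map $\varphi$.** For a heap ordered tree $t$ whose root has label $i$ and whose root's children, in increasing order of root label, are the subtrees $t_1,\dots,t_k$, define recursively the string $\alpha(t)=i\,\alpha(t_k)\cdots\alpha(t_1)$ (so $\alpha(t)=i$ if $k=0$). For a standard heap ordered tree $t\in\mathcal{T}_n$ whose root has children $t_1,\dots,t_k$, put $\varphi(t)=(\alpha(t_1))\cdots(\alpha(t_k))\in\mathfrak{S}_n$, a product of disjoint cycles. *)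

(* Defs.v *)
From HB Require Import structures.
From mathcomp Require Import all_boot all_order all_fingroup all_algebra.
From mathcomp.multinomials Require Import freeg.

Set Implicit Arguments.
Unset Strict Implicit.
Unset Printing Implicit Defensive.

Import GRing.Theory.

Local Open Scope ring_scope.
Local Open Scope nat_scope.

(** * Free vector spaces

    The vector space with basis [I] is [{freeg I / k}], with [<< i >>] the basis
    vector indexed by [i : I].  The tensor product of the spaces with bases [I]
    and [J] is the space with basis [I * J], [<< (i, j) >>] being the tensor
    product of [<< i >>] and [<< j >>]. *)

Definition tens (k : fieldType) (I J : choiceType)
    (x : {freeg I / k}) (y : {freeg J / k}) : {freeg (I * J)%type / k} :=
  fglift (fun i => fglift (fun j => << (i, j) >>%R : {freeg (I * J)%type / k}) y)
    x.

Definition tensmap (k : fieldType) (I J I' J' : choiceType)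
    (f : {freeg I / k} -> {freeg I' / k}) (g : {freeg J / k} -> {freeg J' / k})
    (z : {freeg (I * J)%type / k}) : {freeg (I' * J')%type / k} :=
  fglift (fun p : I * J => tens (f << p.1 >>%R) (g << p.2 >>%R)) z.

Definition bilift (k : fieldType) (I : choiceType)
    (m : I -> I -> {freeg I / k}) (x y : {freeg I / k}) : {freeg I / k} :=
  fglift (fun i => fglift (m i) y) x.

(** * Selections and standardization *)

(** Standardization [st(-, 0)] replaces [j] by its 1-based rank. *)
Definition rank (L : seq nat) (j : nat) : nat := (index j (sort leq L)).+1.

(** The entries of [s] at the positions in [X], in the order of [s]. *)
Definition subfamily (A : Type) (s : seq A) (X : {set 'I_(size s)}) : seq A :=
  [seq tnth (in_tuple s) i | i in X].

(** For [g] assigning to each entry of [s] one of the points [0, ..., n - 1]: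
    the entries of [s] assigned to the point [a], in the order of [s]. *)
Definition assigned (A : Type) (n : nat) (s : seq A) (g : seq 'I_n) (a : nat) :
    seq A :=
  mask [seq (val i == a) | i <- g] s.

(** * Labelled trees

    Siblings are kept in increasing order of their labels (this is required by
    [heap_ordered]); as labels are distinct, each non-planar tree then has
    exactly one representative. *)

Inductive htree : Type := HNode of nat & seq htree.

Fixpoint encode_htree (t : htree) : GenTree.tree void :=
  let: HNode a cs := t in GenTree.Node a [seq encode_htree c | c <- cs].

Fixpoint decode_htree (t : GenTree.tree void) : htree :=
  match t with
  | GenTree.Leaf x => match x with end
  | GenTree.Node a cs => HNode a [seq decode_htree c | c <- cs]
  end.

Lemma htree_nested_ind (P : htree -> Prop) :
  (forall a cs, (forall i, i < size cs -> P (nth (HNode 0 [::]) cs i)) ->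
     P (HNode a cs)) ->
  forall t, P t.
Proof.
move=> H; fix IH 1; case=> a cs; apply: H.
elim: cs => [|c cs IHcs] [|i] /=; try discriminate.
  by move=> _; apply: IH.
exact: IHcs.
Qed.

Lemma encode_htreeK : cancel encode_htree decode_htree.
Proof.
elim/htree_nested_ind=> a cs IH /=; congr HNode; rewrite -map_comp.
apply: (@eq_from_nth _ (HNode 0 [::])); rewrite size_map // => i lt_i.
by rewrite (nth_map (HNode 0 [::])) //= IH.
Qed.

HB.instance Definition _ := Choice.copy htree (can_type encode_htreeK).

Lemma htree_ind_mem (P : htree -> Prop) :
  (forall a cs, {in cs, forall c, P c} -> P (HNode a cs)) -> forall t, P t.
Proof.
move=> H; elim/htree_nested_ind=> a cs IH; apply: H => c c_cs.
by rewrite -(nth_index (HNode 0 [::]) c_cs); apply: IH; rewrite index_mem.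
Qed.

Definition root_label (t : htree) : nat := let: HNode a _ := t in a.

Fixpoint labels (t : htree) : seq nat :=
  let: HNode a cs := t in a :: flatten [seq labels c | c <- cs].

Definition flabels (f : seq htree) : seq nat := flatten [seq labels t | t <- f].

Fixpoint heap_ordered (t : htree) : bool :=
  let: HNode a cs := t in
  [&& all (fun c => a < root_label c) cs,
      sorted (relpre root_label ltn) cs & all heap_ordered cs].

Fixpoint relabel (h : nat -> nat) (t : htree) : htree :=
  let: HNode a cs := t in HNode (h a) [seq relabel h c | c <- cs].

(** A tree with unlabelled root is given by the list of the subtrees rooted at
    the children of its root, [B_-(t)].  In particular [A^+(X, e)] is [X]. *)
Definition standard (f : seq htree) : bool :=
  [&& sorted (relpre root_label ltn) f, all heap_ordered f &
      perm_eq (flabels f) (iota 1 (size (flabels f)))].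

(** The standard heap ordered trees, for all numbers of nodes together. *)
Record stdtree : Type := StdTree { branches :> seq htree ; _ : standard branches }.

HB.instance Definition _ := [isSub for branches].
HB.instance Definition _ := [Choice of stdtree by <:].

(** The [n] such that [t] has [n + 1] nodes, that is, [t] is in [T_n]. *)
Definition degree (t : stdtree) : nat := size (flabels t).

Definition st (m : nat) (f : seq htree) : seq htree :=
  [seq relabel (fun j => rank (flabels f) j + m) t | t <- f].

Definition sort_children : seq htree -> seq htree :=
  sort (relpre root_label leq).

(** Make the trees in [X a] children of the node labelled [a], for every [a]. *)
Fixpoint attach_node (X : nat -> seq htree) (t : htree) : htree :=
  let: HNode a cs := t in
  HNode a (sort_children ([seq attach_node X c | c <- cs] ++ X a)).

(** The same for a tree with unlabelled root; the root is the point [0]. *)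
Definition attach (X : nat -> seq htree) (f : seq htree) : seq htree :=
  sort_children ([seq attach_node X c | c <- f] ++ X 0).

(** ** Closure properties *)

Lemma root_in_labels t : root_label t \in labels t.
Proof. by case: t => a cs; rewrite /= mem_head. Qed.

Lemma flabels_cat f1 f2 : flabels (f1 ++ f2) = flabels f1 ++ flabels f2.
Proof. by rewrite /flabels map_cat flatten_cat. Qed.

Lemma mem_flabels (f : seq htree) t j : t \in f -> j \in labels t -> j \in flabels f.
Proof. by move=> t_f j_t; apply/flatten_mapP; exists t. Qed.

Lemma roots_subseq f : subseq [seq root_label t | t <- f] (flabels f).
Proof.
elim: f => [//|[a cs] f IH]; rewrite /flabels /= eqxx.
by apply: subseq_trans IH _; apply: suffix_subseq.
Qed.

Lemma flabels_perm f1 f2 : perm_eq f1 f2 -> perm_eq (flabels f1) (flabels f2).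
Proof. by move=> f12; apply: perm_flatten; apply: perm_map. Qed.

Lemma perm_sort_children f : perm_eq (sort_children f) f.
Proof. by rewrite perm_sort. Qed.

Lemma sorted_children_uniq f : uniq (flabels f) ->
  sorted (relpre root_label ltn) (sort_children f).
Proof.
move=> Uf; rewrite -sorted_map ltn_sorted_uniq_leq; apply/andP; split.
  rewrite (perm_uniq (perm_map root_label (_ : perm_eq _ f))) ?perm_sort //.
  exact: subseq_uniq (roots_subseq f) Uf.
rewrite sorted_map; apply: sort_sorted => x y /=; exact: leq_total.
Qed.

Lemma labels_relabel h t : labels (relabel h t) = map h (labels t).
Proof.
elim/htree_ind_mem: t => a cs IH /=; congr cons.
rewrite map_flatten -!map_comp; congr flatten.
by apply/eq_in_map => c /IH.
Qed.

Lemma flabels_relabel h f : flabels (map (relabel h) f) = map h (flabels f).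
Proof.
rewrite /flabels map_flatten -!map_comp; congr flatten.
by apply: eq_map => t /=; rewrite labels_relabel.
Qed.

Lemma root_relabel h t : root_label (relabel h t) = h (root_label t).
Proof. by case: t. Qed.

Lemma relabel_sorted h (f : seq htree) :
  {in flabels f &, {homo h : i j / i < j}} ->
  sorted (relpre root_label ltn) f ->
  sorted (relpre root_label ltn) (map (relabel h) f).
Proof.
move=> Hh; rewrite sorted_map.
apply: (sub_in_sorted (P := mem f)) => [x y x_f y_f /=|]; last exact/allP.
rewrite !root_relabel => /Hh -> //.
- exact: mem_flabels x_f (root_in_labels _).
- exact: mem_flabels y_f (root_in_labels _).
Qed.

Lemma relabel_heap h t : {in labels t &, {homo h : i j / i < j}} ->
  heap_ordered t -> heap_ordered (relabel h t).
Proof.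
elim/htree_ind_mem: t => a cs IH Hh /= /and3P[/allP lt_a srt /allP hcs].
have sub : {subset flabels cs <= labels (HNode a cs)}.
  by move=> j; rewrite inE orbC => ->.
apply/and3P; split.
- rewrite all_map; apply/allP=> c c_cs /=; rewrite root_relabel.
  apply: Hh (lt_a c c_cs); first exact: mem_head.
  by apply: sub; apply: mem_flabels c_cs (root_in_labels _).
- by apply: relabel_sorted srt => i j /sub i_t /sub; apply: Hh.
- rewrite all_map; apply/allP=> c c_cs /=; apply: IH (hcs c c_cs) => //.
  by move=> i j i_c j_c; apply: Hh; apply: sub; apply: mem_flabels c_cs _.
Qed.

Lemma rank_homo L m : uniq L ->
  {in L &, {homo (fun j => rank L j + m) : i j / i < j}}.
Proof.
move=> UL i j iL jL lt_ij; rewrite ltn_add2r ltnS.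
have ss : sorted ltn (sort leq L) by rewrite ltn_sorted_uniq_leq sort_uniq UL sort_sorted //; exact: leq_total.
case: ltngtP => // [lt_ji|e].
  have := sorted_ltn_nth ltn_trans 0 ss.
  move=> /(_ (index j (sort leq L)) (index i (sort leq L))).
  rewrite !inE !index_mem !mem_sort => /(_ jL iL lt_ji).
  by rewrite !nth_index ?mem_sort // ltnNge ltnW.
by move: lt_ij; rewrite -(nth_index 0 (_ : j \in sort leq L)) ?mem_sort //
  -e nth_index ?mem_sort // ltnn.
Qed.

Lemma rank_perm L m : uniq L ->
  perm_eq [seq rank L j + m | j <- L] (iota m.+1 (size L)).
Proof.
move=> UL; rewrite (perm_trans (perm_map _ (_ : perm_eq L (sort leq L)))) //.
  by rewrite perm_sym perm_sort.
have -> : [seq rank L j + m | j <- sort leq L] = iota m.+1 (size L).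
  rewrite -(size_sort leq L); apply: (@eq_from_nth _ 0); rewrite size_map ?size_iota //.
  move=> i lt_i; rewrite (nth_map 0) // nth_iota // /rank index_uniq ?sort_uniq //.
  by rewrite addSn addSn addnC.
exact: perm_refl.
Qed.

Lemma standard_uniq f : standard f -> uniq (flabels f).
Proof. by case/and3P=> _ _ /perm_uniq ->; apply: iota_uniq. Qed.

Lemma flabels_st m f : uniq (flabels f) ->
  perm_eq (flabels (st m f)) (iota m.+1 (size (flabels f))).
Proof. by move=> Uf; rewrite /st flabels_relabel; apply: rank_perm. Qed.

Lemma st_heap m f : uniq (flabels f) -> all heap_ordered f ->
  all heap_ordered (st m f).
Proof.
move=> Uf /allP hf; rewrite /st all_map; apply/allP=> t t_f /=.
apply: relabel_heap (hf t t_f) => i j i_t j_t.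
by apply: rank_homo => //; apply: mem_flabels t_f _.
Qed.

Lemma st_standard f : sorted (relpre root_label ltn) f -> all heap_ordered f ->
  uniq (flabels f) -> standard (st 0 f).
Proof.
move=> sf hf Uf; apply/and3P; split.
- by apply: relabel_sorted sf; apply: rank_homo.
- exact: st_heap.
- have e := flabels_st 0 Uf.
  by rewrite (perm_size e) size_iota.
Qed.

Lemma subfamily_subseq (A : eqType) (s : seq A) (X : {set 'I_(size s)}) :
  subseq (subfamily X) s.
Proof.
suff : subseq (subfamily X) [seq tnth (in_tuple s) i | i <- enum 'I_(size s)].
  by rewrite (map_tnth_enum (in_tuple s)).
rewrite /subfamily /image_mem; apply: map_subseq.
by rewrite [Y in subseq _ Y]enumT; apply: filter_subseq.
Qed.

Lemma subseq_flabels f1 f2 : subseq f1 f2 -> subseq (flabels f1) (flabels f2).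
Proof.
elim: f2 f1 => [|t f2 IH] f1; first by rewrite subseq0 => /eqP ->.
case: f1 => [|t1 f1]; first by move=> _; apply: sub0seq.
rewrite /=; case: eqP => [-> /IH|_ /IH] s12; rewrite /flabels /=.
  exact: cat_subseq.
by apply: subseq_trans s12 _; apply: suffix_subseq.
Qed.

Lemma subfamily_standard (t : stdtree) (X : {set 'I_(size t)}) :
  standard (st 0 (subfamily X)).
Proof.
case: t X => f sf /= X; have sub := subfamily_subseq X.
have Uf := standard_uniq sf; case/and3P: sf => sf hf _.
apply: st_standard.
- apply: subseq_sorted sub sf => x y z; exact: ltn_trans.
- by apply/allP=> c /(mem_subseq sub); apply/allP.
- exact: subseq_uniq (subseq_flabels sub) Uf.
Qed.

Lemma labels_attach_node X t :
  perm_eq (labels (attach_node X t))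
    (labels t ++ flatten [seq flabels (X a) | a <- labels t]).
Proof.
elim/htree_ind_mem: t => a cs IH /=; rewrite perm_cons.
have e := perm_sort_children ([seq attach_node X c | c <- cs] ++ X a).
rewrite (perm_trans (flabels_perm e)) // flabels_cat.
rewrite perm_catC perm_sym perm_catCA perm_cat2l perm_sym {e}.
rewrite /flabels; elim: cs IH => [//|c cs IHcs] IH /=.
rewrite map_cat flatten_cat.
apply: perm_trans (perm_cat (IH c (mem_head _ _)) (IHcs _)) _.
  by move=> d d_cs; apply: IH; rewrite inE d_cs orbT.
by rewrite -!catA perm_cat2l perm_catCA.
Qed.

Lemma labels_attach X f :
  perm_eq (flabels (attach X f))
    (flabels f ++ flatten [seq flabels (X a) | a <- 0 :: flabels f]).
Proof.
have := labels_attach_node X (HNode 0 f).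
by rewrite /= perm_cons.
Qed.

Lemma root_attach X t : root_label (attach_node X t) = root_label t.
Proof. by case: t. Qed.

Lemma attach_node_heap X t :
    {in labels t, forall a, all heap_ordered (X a)} ->
    {in labels t, forall a, all (fun c => a < root_label c) (X a)} ->
    uniq (labels (attach_node X t)) -> heap_ordered t ->
  heap_ordered (attach_node X t).
Proof.
elim/htree_ind_mem: t => a cs IH hX ltX U /= /and3P[/allP lt_a srt /allP hcs].
have sub : {subset flabels cs <= labels (HNode a cs)}.
  by move=> j; rewrite inE orbC => ->.
move: U => /= /andP[_ U].
have e := perm_sort_children ([seq attach_node X c | c <- cs] ++ X a).
rewrite (perm_uniq (flabels_perm e)) in U.
apply/and3P; split.
- rewrite (perm_all _ e) all_cat ltX ?mem_head // andbT all_map.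
  by apply/allP=> c /lt_a /=; rewrite root_attach.
- exact: sorted_children_uniq.
- rewrite (perm_all _ e) all_cat hX ?mem_head // andbT all_map.
  apply/allP=> c c_cs /=; apply: IH (hcs _ c_cs) => //.
  + by move=> b b_c; apply: hX; apply: sub; apply: mem_flabels b_c.
  + by move=> b b_c; apply: ltX; apply: sub; apply: mem_flabels b_c.
  move: U; rewrite flabels_cat cat_uniq => /andP[U _].
  apply: subseq_uniq U; have c'_cs := map_f (attach_node X) c_cs.
  case/splitPr: c'_cs => p1 p2; rewrite flabels_cat.
  apply: subseq_trans (suffix_subseq _ _).
  by rewrite /flabels /=; apply: prefix_subseq.
Qed.

Lemma assigned_perm n (s : seq htree) (g : seq 'I_n) : size g = size s ->
  perm_eq (flatten [seq flabels (assigned s g a) | a <- iota 0 n]) (flabels s).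
Proof.
elim: s g => [|t s IH] [|i g] //=.
  by move=> _; elim: (iota 0 n).
case=> /IH {}IH; rewrite -[flabels (t :: s)]/(labels t ++ flabels s).
apply: (@perm_trans _ (labels t ++ flatten [seq flabels (assigned s g a) | a <- iota 0 n]));
  last by rewrite perm_cat2l.
have E b : flabels (assigned (t :: s) (i :: g) b) =
    (if val i == b then labels t else [::]) ++ flabels (assigned s g b).
  by rewrite /assigned /=; case: eqP.
have : val i \in iota 0 n by rewrite mem_iota add0n ltn_ord.
move: (iota_uniq 0 n); elim: (iota 0 n) => [//|a r IHr] /= /andP[a_r Ur].
rewrite inE E; case: eqP => [ia _|_ /= /(IHr Ur) {}IHr].
  rewrite -catA !perm_cat2l (_ : map _ r = [seq flabels (assigned s g b) | b <- r]) //.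
  apply/eq_in_map => b b_r; rewrite E; case: eqP => // ib.
  by move: a_r; rewrite -ia ib b_r.
by rewrite perm_sym perm_catCA perm_sym perm_cat2l.
Qed.

Lemma assigned_subseq n (s : seq htree) (g : seq 'I_n) a :
  subseq (assigned s g a) s.
Proof. exact: mask_subseq. Qed.

Lemma flabels_product (t1 t2 : stdtree) (g : seq 'I_(degree t2).+1) :
    size g = size (st (degree t2) t1) ->
  perm_eq (flabels (attach (assigned (st (degree t2) t1) g) t2))
    (iota 1 (degree t1 + degree t2)).
Proof.
case: t1 t2 g => [f1 std1] [f2 std2] /=; rewrite /degree /= => g sz_g.
have /and3P[_ _ p2] := std2; set n := size (flabels f2) in g sz_g p2 *.
apply: perm_trans (labels_attach _ _) _.
rewrite addnC iotaD; apply: perm_cat => //.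
have p0 : perm_eq (0 :: flabels f2) (iota 0 n.+1) by rewrite /= perm_cons.
apply: perm_trans (perm_flatten (perm_map _ p0)) _.
apply: perm_trans (assigned_perm sz_g) _.
by rewrite add1n; apply: flabels_st; apply: standard_uniq.
Qed.

Lemma attach_standard (t1 t2 : stdtree)
    (g : (size (st (degree t2) t1)).-tuple 'I_(degree t2).+1) :
  standard (attach (assigned (st (degree t2) t1) g) t2).
Proof.
have pL := flabels_product (size_tuple g).
have U := perm_uniq pL; rewrite iota_uniq in U.
apply/and3P; split; last by rewrite (perm_size pL) size_iota.
  apply: sorted_children_uniq.
  by rewrite -(perm_uniq (flabels_perm (perm_sort_children _))).
have : heap_ordered (attach_node (assigned (st (degree t2) t1) g) (HNode 0 t2)); last first.
  by case/and3P.
have h1 : all heap_ordered (st (degree t2) t1).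
  by have /and3P[_ h1 _] := valP t1; apply: st_heap => //; apply: standard_uniq (valP t1).
have /and3P[s2 h2 p2] := valP t2.
have le_n a : a \in labels (HNode 0 t2) -> a <= degree t2.
  rewrite inE => /predU1P[->//|]; rewrite -/(flabels t2) (perm_mem p2) mem_iota.
  by rewrite add1n ltnS => /andP[].
apply: attach_node_heap.
- move=> a _; apply/allP=> t /(mem_subseq (assigned_subseq _ _ _)).
  exact/allP.
- move=> a /le_n le_a; apply/allP=> t /(mem_subseq (assigned_subseq _ _ _)) t_st.
  apply: leq_ltn_trans le_a _.
  have := mem_flabels t_st (root_in_labels t).
  rewrite (perm_mem (flabels_st _ (standard_uniq (valP t1)))) mem_iota.
  by case/andP.
- rewrite /=; apply/andP; split; last exact: U.
  by rewrite (perm_mem pL) mem_iota.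
- rewrite /=; apply/and3P; split=> //.
  apply/allP=> t t_t2; have := mem_flabels t_t2 (root_in_labels t).
  by rewrite (perm_mem p2) mem_iota; case/andP.
Qed.

(** * The bialgebra of standard heap ordered trees *)

Notation kT k := {freeg stdtree / k}.

Definition emptytree : stdtree := @StdTree [::] isT.

Definition unitT (k : fieldType) : kT k := << emptytree >>%R.

(** The sum over the assignments [g] of a point of [t2] to each subtree of
    [st(t1, n)], the point [0] being the root of [t2] and the point [a] in
    [1, ..., n] being the node with label [a]. *)
Definition prodT_basis (k : fieldType) (t1 t2 : stdtree) : kT k :=
  (\sum_(g : (size (st (degree t2) t1)).-tuple 'I_(degree t2).+1)
     << StdTree (attach_standard g) >>)%R.

Definition prodT (k : fieldType) : kT k -> kT k -> kT k :=
  bilift (@prodT_basis k).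

Definition coprodT_basis (k : fieldType) (t : stdtree) :
    {freeg (stdtree * stdtree)%type / k} :=
  (\sum_(X : {set 'I_(size t)})
     << (StdTree (subfamily_standard X), StdTree (subfamily_standard (~: X))) >>)%R.

Definition coprodT (k : fieldType) (x : kT k) :
    {freeg (stdtree * stdtree)%type / k} :=
  fglift (@coprodT_basis k) x.

Definition counitT (k : fieldType) (x : kT k) : k :=
  fglift (fun t => ((t == emptytree)%:R : k^o)%R) x.

(** * Permutations as products of cycles

    Strings are sequences over [{1, ..., n}], whereas ['S_n] acts on
    [{0, ..., n - 1}]: the entry [j.+1] of a string stands for [j : 'I_n]. *)

(** The permutations of all sizes together. *)
Definition symT : choiceType := {n : nat & 'S_n}.

(** The cycle [(a_1 ... a_p)].  The entries [a_i] are meant to be distinct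
    elements of [{1, ..., n}], in which case [pmap] drops nothing and [undup]
    is the identity. *)
Definition cycle_of (n : nat) (s : seq nat) : 'S_n :=
  perm (can_inj (prev_next (undup_uniq (pmap (fun a => insub a.-1) s)))).

Definition perm_of_strings (n : nat) (ss : seq (seq nat)) : 'S_n :=
  (\prod_(s <- ss) cycle_of n s)%g.

(** The strings of the cycles of [p] (1-cycles included), in standard order. *)
Definition strings (n : nat) (p : 'S_n) : seq (seq nat) :=
  [seq [seq (val j).+1 | j <- fingraph.orbit p i] |
     i : 'I_n <- rev (enum 'I_n) & all (fun j : 'I_n => i <= j) (fingraph.orbit p i)].

Definition standard_order (ss : seq (seq nat)) : bool :=
  all (fun s => (s != [::]) && all (leq (head 0 s)) s) ss &&
  sorted gtn [seq head 0 s | s <- ss].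

Lemma strings_standard_order n (p : 'S_n) : standard_order (strings p).
Proof.
rewrite /standard_order /strings; apply/andP; split.
  rewrite all_map; apply/allP=> i; rewrite mem_filter => /andP[/allP min_i _] /=.
  rewrite /fingraph.orbit -orderSpred /= leqnn /= all_map.
  apply/allP=> j j_i /=; rewrite ltnS; apply: min_i.
  by rewrite /fingraph.orbit -orderSpred /= inE j_i orbT.
rewrite -map_comp (eq_map (g := fun i : 'I_n => (val i).+1)); last first.
  by move=> i /=; rewrite /fingraph.orbit -orderSpred.
rewrite sorted_map; apply: sorted_filter => [i j l /= ij jl|].
  exact: leq_trans jl (ltnW ij).
rewrite rev_sorted.
have := iota_ltn_sorted 0 n; rewrite -val_enum_ord sorted_map.
by apply: sub_sorted.
Qed.

Lemma cycle_of_orbit n (p : 'S_n) (i x : 'I_n) :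
  cycle_of n [seq (val j).+1 | j <- fingraph.orbit p i] x =
  if x \in fingraph.orbit p i then p x else x.
Proof.
rewrite permE map_pK; last by move=> j /=; rewrite valK.
rewrite (undup_id (orbit_uniq _ _)); case: ifPn => [x_i|x_i].
  by have /eqP := next_cycle (cycle_orbit (@perm_inj _ p) i) x_i.
by rewrite next_nth (negbTE x_i).
Qed.

Lemma strings_perm n (p : 'S_n) : perm_of_strings n (strings p) = p.
Proof.
set P := fun i : 'I_n => all (fun j : 'I_n => i <= j) (fingraph.orbit p i).
have orbP i x : (x \in fingraph.orbit p i) = fconnect p i x.
  by rewrite -fconnect_orbit.
have sym := fconnect_sym (@perm_inj _ p).
have inj (i j : 'I_n) x : P i -> P j ->
    x \in fingraph.orbit p i -> x \in fingraph.orbit p j -> i = j.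
  move=> /allP Pi /allP Pj; rewrite !orbP => ix jx; apply/val_inj/eqP.
  by rewrite eqn_leq Pi ?Pj // orbP; [rewrite (connect_trans jx) // sym
                                    | rewrite (connect_trans ix) // sym].
suff H (r : seq 'I_n) x : all P r -> uniq r ->
    (\prod_(i <- r) cycle_of n [seq (val j).+1 | j <- fingraph.orbit p i])%g x =
    if has (fun i => x \in fingraph.orbit p i) r then p x else x.
  apply/permP=> x; rewrite /perm_of_strings /strings big_map H ?filter_all //; last first.
    by rewrite filter_uniq // rev_uniq enum_uniq.
  case: ifPn => // /hasPn nx; exfalso.
  have [i i_x min_i] := arg_minnP val (connect0 (frel p) x : fconnect p x x).
  have /nx : i \in [seq i : 'I_n <- rev (enum 'I_n) | P i].
    rewrite mem_filter mem_rev mem_enum andbT; apply/allP=> j.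
    by rewrite orbP => ij; apply: min_i; apply: connect_trans i_x ij.
  by rewrite orbP sym i_x.
elim: r x => [|i r IH] x /=; first by rewrite big_nil perm1.
case/andP=> Pi Pr /andP[i_r Ur]; rewrite big_cons permM cycle_of_orbit IH //.
case x_i: (x \in fingraph.orbit p i) => //=.
rewrite ifN //; apply/hasPn=> j j_r; apply/negP=> px_j.
have px_i : p x \in fingraph.orbit p i.
  by move: x_i; rewrite !orbP => ix; apply: connect_trans ix (fconnect1 _ _).
by move: i_r; rewrite (inj _ _ _ Pi (allP Pr j j_r) px_i px_j) j_r.
Qed.

(** Insert, directly to the right of each entry [a] of [s], the concatenation
    of the strings in [X a]. *)
Definition insert_in_string (X : nat -> seq (seq nat)) (s : seq nat) : seq nat :=
  flatten [seq a :: flatten (X a) | a <- s].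

Definition insert_strings (X : nat -> seq (seq nat)) (ss : seq (seq nat)) :
    seq (seq nat) :=
  [seq insert_in_string X s | s <- ss] ++ X 0.

(** * The bialgebra of permutations *)

Notation kS k := {freeg symT / k}.

Definition unitS (k : fieldType) : kS k :=
  << (Tagged (fun n => 'S_n) (1%g : 'S_0) : symT) >>%R.

(** The strings of [sigma], shifted by [n], are assigned to the points
    [0, ..., n], where [0] is the extra attachment point. *)
Definition heapprod_basis (k : fieldType) (sigma tau : symT) : kS k :=
  let m := tag sigma in
  let n := tag tau in
  let ss := [seq [seq n + a | a <- s] | s <- strings (tagged sigma)] in
  (\sum_(g : (size ss).-tuple 'I_n.+1)
     << (Tagged (fun l => 'S_l)
           (perm_of_strings (m + n)
              (insert_strings (assigned ss g) (strings (tagged tau)))) : symT) >>)%R.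

Definition heapprod (k : fieldType) : kS k -> kS k -> kS k :=
  bilift (@heapprod_basis k).

Definition rho (ss : seq (seq nat)) : symT :=
  Tagged (fun l => 'S_l)
    (perm_of_strings (size (flatten ss))
       [seq [seq rank (flatten ss) a | a <- s] | s <- ss]).

Definition coprodS_basis (k : fieldType) (p : symT) :
    {freeg (symT * symT)%type / k} :=
  (\sum_(X : {set 'I_(size (strings (tagged p)))})
     << (rho (subfamily X), rho (subfamily (~: X))) >>)%R.

Definition coprodS (k : fieldType) (x : kS k) : {freeg (symT * symT)%type / k} :=
  fglift (@coprodS_basis k) x.

Definition counitS (k : fieldType) (x : kS k) : k :=
  fglift (fun p : symT => ((tag p == 0)%:R : k^o)%R) x.

(** * The map from trees to permutations *)

Fixpoint alpha (t : htree) : seq nat :=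
  let: HNode i ts := t in i :: flatten (rev [seq alpha u | u <- ts]).

Definition phi_basis (t : stdtree) : symT :=
  Tagged (fun n => 'S_n)
    (perm_of_strings (degree t) [seq alpha u | u <- branches t]).

Definition phi (k : fieldType) (x : kT k) : kS k :=
  fglift (fun t => << phi_basis t >>%R : kS k) x.

(* Main.v *)
From HB Require Import structures.
Require Import Defs.
From mathcomp Require Import all_boot all_order all_fingroup all_algebra.
From mathcomp.multinomials Require Import freeg.

(** The string [alpha u] starts with the root label of [u], which is its smallest
    entry, so reversing the list of the strings of the branches of [t] writes
    [phi t] in standard order.  Attaching trees below a node [a] puts them after
    the old children of [a], as their labels are larger; since [alpha] reads
    children from right to left, the new strings land directly to the right of
    [a], in standard order.  Both products are thus sums over the same
    assignments, and both coproducts sums over the same subsets, up to reversal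
    of the list of branches. *)

Set Implicit Arguments.
Unset Strict Implicit.
Unset Printing Implicit Defensive.

Import GRing.Theory.

Local Open Scope ring_scope.
Local Open Scope nat_scope.

(** * Products of disjoint cycles and uniqueness of the standard order *)

Section DisjointCycles.

Variable n : nat.

(** Lifting strings to sequences of ordinals makes the partial decoding in [cycle_of] total, so that
    a cycle acts as [next]. *)
Definition ord_string (o : seq 'I_n) : seq nat := [seq (val j).+1 | j <- o].

Lemma ord_stringP (s : seq nat) :
  {subset s <= iota 1 n} -> exists o, s = ord_string o.
Proof.
elim: s => [|a s IH] sub; first by exists [::].
have [o ->] : exists o, s = ord_string o.
  by apply: IH => x x_s; apply: sub; rewrite inE x_s orbT.
have := sub a (mem_head _ _); case: a {sub} => [|a]; rewrite mem_iota //=.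
rewrite add1n ltnS => lt_a.
by exists (Ordinal lt_a :: o).
Qed.

Lemma ord_stringsP (ss : seq (seq nat)) :
  {subset flatten ss <= iota 1 n} -> exists oo, ss = map ord_string oo.
Proof.
elim: ss => [|s ss IH] sub; first by exists [::].
have [|o ->] := @ord_stringP s.
  by move=> x x_s; apply: sub; rewrite /= mem_cat x_s.
have [|oo ->] := IH.
  by move=> x x_s; apply: sub; rewrite /= mem_cat x_s orbT.
by exists (o :: oo).
Qed.

Lemma ord_succ_inj : injective (fun j : 'I_n => (val j).+1).
Proof. by move=> i j [/val_inj]. Qed.

Lemma ord_string_inj : injective ord_string.
Proof. exact/inj_map/ord_succ_inj. Qed.

Lemma ord_strings_cover (oo : seq (seq 'I_n)) :
    perm_eq (flatten (map ord_string oo)) (iota 1 n) ->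
  uniq (flatten oo) /\ forall x, x \in flatten oo.
Proof.
rewrite -map_flatten => p_oo; split=> [|x].
  by rewrite -(map_inj_uniq ord_succ_inj) (perm_uniq p_oo) iota_uniq.
rewrite -(mem_map ord_succ_inj) (perm_mem p_oo) mem_iota add1n ltnS.
exact: ltn_ord.
Qed.

Lemma cycle_of_ord_string (o : seq 'I_n) x :
  uniq o -> cycle_of n (ord_string o) x = next o x.
Proof.
by move=> Uo; rewrite permE map_pK ?undup_id // => j /=; rewrite valK.
Qed.

(** Only the factor of the string containing [x] moves [x]. The image stays in that string, so the
    factors applied afterwards fix it by disjointness. *)
Lemma perm_of_strings_next (oo : seq (seq 'I_n)) o x :
    uniq (flatten oo) -> o \in oo -> x \in o ->
  perm_of_strings n (map ord_string oo) x = next o x.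
Proof.
have fixed (oo' : seq (seq 'I_n)) y :
    uniq (flatten oo') -> y \notin flatten oo' ->
    perm_of_strings n (map ord_string oo') y = y.
  rewrite /perm_of_strings; elim: oo' y => [|o' oo' IH] y /=.
    by rewrite big_nil perm1.
  rewrite cat_uniq mem_cat negb_or => /and3P[Uo _ Uoo] /andP[y_o y_oo].
  by rewrite big_cons permM cycle_of_ord_string // next_nth (negbTE y_o) IH.
elim: oo => [|o' oo IH] //=.
rewrite cat_uniq => /and3P[Uo /hasPn disj Uoo].
rewrite inE {1}/perm_of_strings big_cons permM.
rewrite cycle_of_ord_string // -/(perm_of_strings n (map ord_string oo)).
have [-> _ x_o|ne /= o_oo x_o] := eqVneq o o'.
  rewrite fixed //; apply/negP=> /disj /=.
  by rewrite mem_next x_o.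
have x_oo : x \in flatten oo by apply/flattenP; exists o.
by rewrite next_nth (negbTE (disj x x_oo)) IH.
Qed.

(** Disjoint cycles commute: the image of each point depends only on the string containing it. *)
Lemma perm_of_strings_perm (ss ss' : seq (seq nat)) :
    perm_eq (flatten ss) (iota 1 n) -> perm_eq ss ss' ->
  perm_of_strings n ss = perm_of_strings n ss'.
Proof.
move=> p_ss p_ss'; have [|oo def_ss] := @ord_stringsP ss.
  by move=> a; rewrite (perm_mem p_ss).
have [|oo' def_ss'] := @ord_stringsP ss'.
  by move=> a; rewrite -(perm_mem (perm_flatten p_ss')) (perm_mem p_ss).
have p_oo : perm_eq oo oo'.
  by apply: (perm_map_inj ord_string_inj); rewrite -def_ss -def_ss'.
move: p_ss; rewrite def_ss def_ss' => /ord_strings_cover[U cover].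
apply/permP=> x; have /flattenP[o o_oo x_o] := cover x.
rewrite !(@perm_of_strings_next _ o) // -?(perm_mem p_oo) //.
by rewrite -(perm_uniq (perm_flatten p_oo)).
Qed.

(** Each string is the orbit of its first entry, and the first entries are exactly the minima of the
    orbits, so the decreasing order leaves no choice. *)
Lemma strings_perm_of_strings (ss : seq (seq nat)) :
    perm_eq (flatten ss) (iota 1 n) -> standard_order ss ->
  strings (perm_of_strings n ss) = ss.
Proof.
move=> p_ss; have [|oo def_ss] := @ord_stringsP ss.
  by move=> a; rewrite (perm_mem p_ss).
rewrite {}def_ss in p_ss *; have [U cover] := ord_strings_cover p_ss.
rewrite /standard_order => /andP[/allP std_oo sorted_oo].
set p := perm_of_strings n _.
have next_p o x : o \in oo -> x \in o -> p x = next o x.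
  by move=> o_oo x_o; apply: perm_of_strings_next.
have orbit_p h o : h :: o \in oo -> fingraph.orbit p h = h :: o.
  move=> o_oo; have Uo : uniq (h :: o).
    apply: subseq_uniq U; case/splitPr: o_oo => o1 o2; rewrite flatten_cat /=.
    by apply: subseq_trans (suffix_subseq _ _); apply: (prefix_subseq (h :: o)).
  rewrite (@fingraph.orbitE _ p (h :: o)) ?mem_head //; first by rewrite /= eqxx rot0.
  by apply: cycle_from_next => // x x_o /=; rewrite (next_p (h :: o)).
have min_oo h o : h :: o \in oo -> all (fun j : 'I_n => h <= j) (h :: o).
  move=> o_oo; have /andP[_] := std_oo _ (map_f ord_string o_oo).
  by rewrite /ord_string /= all_map !leqnn.
have def_oo : oo = map (fingraph.orbit p) (pmap ohead oo).
  have : forall o, o \in oo -> o != [::].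
    move=> o o_oo; have /andP[+ _] := std_oo _ (map_f ord_string o_oo).
    by case: (o).
  (* The trivial inclusion is generalized so that the induction runs over a part of [oo] while
     membership still refers to the full list. *)
  move=> ne; have sub : {subset oo <= oo} by [].
  elim: {1 3 4}oo sub => [|[|h o] oo1 IH] sub //=.
    by have := ne _ (sub _ (mem_head _ _)).
  rewrite (orbit_p h o) -?IH //; last exact: sub (mem_head _ _).
  by move=> o' o'_oo; apply: sub; rewrite inE o'_oo orbT.
rewrite /strings {1}def_oo -map_comp; congr map.
(* Two strictly decreasing lists with the same elements are equal; these are the orbit minima and
   the heads of [oo]. *)
apply: (@irr_sorted_eq _ (fun i j : 'I_n => j < i)).
- by move=> i j l /= ij jl; apply: ltn_trans jl ij.
- by move=> i; apply: ltnn.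
- apply: sorted_filter; first by move=> i j l /= ij jl; apply: ltn_trans jl ij.
  rewrite rev_sorted; have := iota_ltn_sorted 0 n; rewrite -val_enum_ord sorted_map.
  by apply: sub_sorted.
- move: sorted_oo; rewrite {1}def_oo -!map_comp.
  rewrite (eq_map (g := fun i : 'I_n => (val i).+1)); first by rewrite sorted_map.
  by move=> i /=; rewrite /fingraph.orbit -orderSpred.
move=> i; rewrite mem_filter mem_rev mem_enum andbT; apply/idP/idP.
  (* The head [h] of the string through [i] lies in the orbit of [i], and each of the two is minimal
     there, hence [i = h]. *)
  move=> /allP min_i; have /flattenP[[|h o] o_oo i_o] := cover i; first by [].
  have : h \in fingraph.orbit p i.
    rewrite -fconnect_orbit fconnect_sym; last exact: perm_inj.
    by rewrite fconnect_orbit (orbit_p _ _ o_oo).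
  move/min_i => le_ih; have /allP/(_ i i_o) le_hi := min_oo _ _ o_oo.
  have -> : i = h by apply/val_inj/eqP; rewrite eqn_leq le_ih.
  by rewrite mem_pmap; apply/mapP; exists (h :: o).
rewrite mem_pmap => /mapP[[|h o] o_oo] //= [->].
by rewrite (orbit_p _ _ o_oo); apply: min_oo.
Qed.

End DisjointCycles.

(** * Strings of heap ordered trees *)

Lemma alpha_relabel h t : alpha (relabel h t) = map h (alpha t).
Proof.
elim/htree_ind_mem: t => a cs IH /=; congr cons.
rewrite map_flatten map_rev -!map_comp; congr (flatten (rev _)).
by apply/eq_in_map => c /IH.
Qed.

Lemma perm_alpha t : perm_eq (alpha t) (labels t).
Proof.
elim/htree_ind_mem: t => a cs IH /=; rewrite perm_cons.
apply: (@perm_trans _ (flatten [seq alpha c | c <- cs])).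
  by apply: perm_flatten; rewrite perm_rev.
elim: cs IH => //= c cs IHcs IH; apply: perm_cat; first exact/IH/mem_head.
by apply: IHcs => d d_cs; apply: IH; rewrite inE d_cs orbT.
Qed.

Lemma perm_alphas f : perm_eq (flatten (map alpha f)) (flabels f).
Proof. by elim: f => //= t f IH; apply: perm_cat IH; apply: perm_alpha. Qed.

Lemma perm_rev_alphas f : perm_eq (flatten (rev (map alpha f))) (flabels f).
Proof.
by apply: perm_trans (perm_alphas f); apply: perm_flatten; rewrite perm_rev.
Qed.

Lemma heap_ordered_root_min t :
  heap_ordered t -> all (leq (root_label t)) (labels t).
Proof.
elim/htree_ind_mem: t => a cs IH /= /and3P[/allP lt_a _ /allP h_cs].
rewrite leqnn; apply/allP=> b /flattenP[_ /mapP[c c_cs ->] b_c].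
apply: leq_trans (ltnW (lt_a _ c_cs)) _.
by have /allP := IH c c_cs (h_cs c c_cs); apply.
Qed.

Lemma rev_alphas_standard_order (f : seq htree) :
    sorted (relpre root_label ltn) f -> all heap_ordered f ->
  standard_order (rev (map alpha f)).
Proof.
move=> srt /allP h_f; apply/andP; split.
  rewrite all_rev all_map; apply/allP=> t /h_f /heap_ordered_root_min.
  rewrite -(perm_all _ (perm_alpha t)).
  by case: t => a cs /= ->.
rewrite map_rev rev_sorted -map_comp sorted_map.
by apply: sub_sorted srt => -[a cs] [b ds].
Qed.

(** This turns the index sets of both operations on permutations, which run over the strings of
    [phi_basis t], into index sets over the reversed branches of [t]. *)
Lemma strings_phi_basis (t : stdtree) :
  strings (tagged (phi_basis t)) = rev (map alpha t).
Proof.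
case: t => f std_f; have /and3P[srt h_f p_f] := std_f.
have p_a : perm_eq (flatten (map alpha f)) (iota 1 (size (flabels f))).
  exact: perm_trans (perm_alphas f) p_f.
rewrite /phi_basis /degree /=.
rewrite (perm_of_strings_perm p_a (ss' := rev (map alpha f))); last first.
  by rewrite perm_sym perm_rev.
apply: strings_perm_of_strings; last exact: rev_alphas_standard_order.
exact: perm_trans (perm_rev_alphas f) p_f.
Qed.

(** * Relabelling and standardization *)

Lemma relabel_eq_in h1 h2 t :
  {in labels t, h1 =1 h2} -> relabel h1 t = relabel h2 t.
Proof.
elim/htree_ind_mem: t => a cs IH h12 /=; rewrite h12 ?mem_head //; congr HNode.
apply/eq_in_map => c c_cs; apply: IH => // b b_c; apply: h12.
by rewrite /= inE; apply/orP; right; apply: mem_flabels b_c.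
Qed.

Lemma rank_perm_eq L L' : perm_eq L L' -> rank L =1 rank L'.
Proof.
move=> p_L j; rewrite /rank; congr (index j _).+1.
exact/(perm_sortP leq_total leq_trans anti_leq).
Qed.

Lemma rank_iota L j : perm_eq L (iota 1 (size L)) -> j \in L -> rank L j = j.
Proof.
move=> p_L; rewrite (rank_perm_eq p_L) (perm_mem p_L) /rank.
rewrite sorted_sort ?iota_sorted //; last exact: leq_trans.
rewrite mem_iota; case: j => // j /=; rewrite add1n ltnS => lt_j.
(* Both [rank] and the list start at 1: the entry [j.+1] sits at index [j]. *)
by rewrite -[X in index X]add1n -(nth_iota 0 1 lt_j) index_uniq ?size_iota ?iota_uniq.
Qed.

(** The labels of a standard tree are their own ranks, so standardizing only shifts them, exactly as
    the heap product shifts its left factor. *)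
Lemma st_shift n (t : stdtree) : st n t = [seq relabel (addn n) u | u <- t].
Proof.
have /and3P[_ _ p_t] := valP t; apply/eq_in_map => u u_t.
apply: relabel_eq_in => j j_u; have j_t := mem_flabels u_t j_u.
by rewrite rank_iota // addnC.
Qed.

(** * Attaching trees and inserting strings *)

Lemma sort_children_sorted f :
  sorted (relpre root_label ltn) f -> sort_children f = f.
Proof.
move=> srt; apply: sorted_sort.
  by move=> x y z; apply: leq_trans.
by apply: sub_sorted srt => x y; apply: ltnW.
Qed.

Lemma sorted_children_cat n (f1 f2 : seq htree) :
    sorted (relpre root_label ltn) f1 -> sorted (relpre root_label ltn) f2 ->
    all (fun t => root_label t <= n) f1 -> all (fun t => n < root_label t) f2 ->
  sorted (relpre root_label ltn) (f1 ++ f2).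
Proof.
have tr : transitive (relpre root_label ltn) by move=> x y z; apply: ltn_trans.
rewrite !sorted_pairwise // pairwise_cat => -> -> /allP le1 /allP lt2.
rewrite !andbT; apply/allrelP => t1 t2 /le1 le /lt2 lt.
exact: leq_ltn_trans le lt.
Qed.

Lemma sort_children_attach n X (cs f : seq htree) :
    sorted (relpre root_label ltn) cs -> all (fun t => root_label t <= n) cs ->
    sorted (relpre root_label ltn) f -> all (fun t => n < root_label t) f ->
  sort_children ([seq attach_node X c | c <- cs] ++ f) =
    [seq attach_node X c | c <- cs] ++ f.
Proof.
move=> srt_cs le_cs srt_f lt_f; apply: sort_children_sorted.
apply: (@sorted_children_cat n) => //.
  rewrite sorted_map; apply: sub_sorted srt_cs => x y /=.
  by rewrite !root_attach.
by rewrite all_map; apply: sub_all le_cs => x /=; rewrite root_attach.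
Qed.

(** The reversal lists the strings attached at [a] by decreasing first entry when [X a] is sorted by
    increasing root label. *)
Definition alphas_at (X : nat -> seq htree) (a : nat) : seq (seq nat) :=
  rev (map alpha (X a)).

Lemma insert_in_string_flatten X ss :
  insert_in_string X (flatten ss) = flatten (map (insert_in_string X) ss).
Proof.
elim: ss => //= s ss IH.
by rewrite -IH /insert_in_string map_cat flatten_cat.
Qed.

(** The bound [n] separates old labels from new ones at every node, so re-sorting the children
    leaves the new trees last. Induction on the old tree suffices, since nothing is attached inside
    the trees of [X]. *)
Lemma alpha_attach_node n X t :
    (forall a, sorted (relpre root_label ltn) (X a)) ->
    (forall a, all (fun u => n < root_label u) (X a)) ->
    heap_ordered t -> all (leq^~ n) (labels t) ->
  alpha (attach_node X t) = insert_in_string (alphas_at X) (alpha t).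
Proof.
move=> srtX ltX; elim/htree_ind_mem: t => a cs IH.
move=> /= /and3P[_ srt /allP h_cs] /andP[_ /allP le_cs].
have le_c c : c \in cs -> all (leq^~ n) (labels c).
  by move=> c_cs; apply/allP=> b b_c; apply: le_cs (mem_flabels c_cs b_c).
rewrite (@sort_children_attach n) //; last first.
  by apply/allP=> c /le_c /allP; apply; apply: root_in_labels.
rewrite map_cat rev_cat flatten_cat.
(* This exposes the block inserted after [a]; it matches the new children, which [alpha] reads
   before the old ones. *)
rewrite -[RHS]/(a :: flatten (alphas_at X a) ++ insert_in_string _ _).
rewrite insert_in_string_flatten map_rev -!map_comp; congr (_ :: _ ++ flatten (rev _)).
by apply/eq_in_map=> c c_cs; apply: IH => //; [apply: h_cs | apply: le_c].
Qed.

(** At the unlabelled root no reversal takes place, so the new strings come after the old ones; they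
    become separate cycles. *)
Lemma alphas_attach n X (f : seq htree) :
    (forall a, sorted (relpre root_label ltn) (X a)) ->
    (forall a, all (fun u => n < root_label u) (X a)) ->
    sorted (relpre root_label ltn) f -> all heap_ordered f ->
    all (leq^~ n) (flabels f) ->
  [seq alpha u | u <- attach X f] =
    [seq insert_in_string (alphas_at X) (alpha u) | u <- f] ++ map alpha (X 0).
Proof.
move=> srtX ltX srt /allP h_f /allP le_f; rewrite /attach (@sort_children_attach n) //.
  rewrite map_cat -map_comp; congr cat; apply/eq_in_map => u u_f /=.
  apply: (alpha_attach_node srtX ltX) (h_f _ u_f) _.
  by apply/allP=> b b_u; apply: le_f (mem_flabels u_f b_u).
by apply/allP=> u u_f; apply: le_f (mem_flabels u_f (root_in_labels u)).
Qed.

Lemma assigned_rev_map (A B : Type) (h : A -> B) n (s : seq A) (g : seq 'I_n) a :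
    size g = size s ->
  assigned (rev (map h s)) (rev g) a = rev (map h (assigned s g a)).
Proof.
by move=> sz_g; rewrite /assigned map_mask rev_mask ?map_rev // !size_map.
Qed.

Lemma eq_insert_strings X Y ss :
  X =1 Y -> insert_strings X ss = insert_strings Y ss.
Proof.
move=> XY; rewrite /insert_strings XY; congr (_ ++ _); apply: eq_map => s.
by congr flatten; apply: eq_map => a; rewrite XY.
Qed.

(** The assignment is reversed because the standard order lists the branches backwards: each branch
    keeps its attachment point. The two lists of cycles then differ only in order. *)
Lemma phi_basis_attach (t1 t2 : stdtree)
    (g : (size (st (degree t2) t1)).-tuple 'I_(degree t2).+1) :
  phi_basis (StdTree (attach_standard g)) =
    Tagged (fun n => 'S_n)
      (perm_of_strings (degree t1 + degree t2)
         (insert_strings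
            (assigned (rev (map alpha (st (degree t2) t1))) (rev g))
            (rev (map alpha t2)))).
Proof.
have pL := flabels_product (size_tuple g).
set X := assigned (st (degree t2) t1) g in pL *.
rewrite /phi_basis /degree /= -/(degree t2) -/X (perm_size pL) size_iota.
congr Tagged; rewrite (@eq_insert_strings _ (alphas_at X)); last first.
  by move=> a; rewrite assigned_rev_map // size_tuple.
apply: perm_of_strings_perm; first exact: perm_trans (perm_alphas _) pL.
have /and3P[srt2 h2 p2] := valP t2; have /and3P[srt1 h1 p1] := valP t1.
have U1 := standard_uniq (valP t1).
rewrite (@alphas_attach (degree t2)) //.
- rewrite /insert_strings /alphas_at !map_rev -map_comp; apply: perm_cat.
    by rewrite perm_sym perm_rev.
  by rewrite perm_sym perm_rev.
- move=> a; apply: subseq_sorted (assigned_subseq _ _ _) _.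
    by move=> x y z; apply: ltn_trans.
  by apply: relabel_sorted srt1; apply: rank_homo.
- move=> a; apply/allP=> u /(mem_subseq (assigned_subseq _ _ _)) u_st.
  have := mem_flabels u_st (root_in_labels u).
  by rewrite (perm_mem (flabels_st _ U1)) mem_iota => /andP[].
- by apply/allP=> a; rewrite (perm_mem p2) mem_iota add1n ltnS => /andP[].
Qed.

(** * Sums over assignments and subsets under reversal *)

(** Reversal is an involution on tuples. Taking [F] on sequences lets the length in the tuple type
    be rewritten. *)
Lemma sum_tuple_rev_map (V : nmodType) (A B : Type) (T : finType) (h : A -> B)
    (s : seq A) (F : seq T -> V) :
  (\sum_(g : (size (rev (map h s))).-tuple T) F g =
   \sum_(g : (size s).-tuple T) F (rev g))%R.
Proof.
rewrite size_rev size_map (reindex_inj (h := @rev_tuple _ T)) //.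
by apply: inv_inj => g; apply: val_inj; apply: revK.
Qed.

Lemma subfamily_mask (A : Type) (s : seq A) (X : {set 'I_(size s)}) :
  subfamily X = mask [tuple i \in X | i < size s] s.
Proof.
rewrite /subfamily /image_mem /enum_mem -enumT filter_mask map_mask.
by rewrite (map_tnth_enum (in_tuple s)).
Qed.

(** Subsets are replaced by their indicator tuples, with complement becoming negation, so that
    reversal of tuples also handles the coproduct. *)
Lemma sum_subfamily (V : nmodType) (A : Type) (s : seq A)
    (F : seq A -> seq A -> V) :
  (\sum_(X : {set 'I_(size s)}) F (subfamily X) (subfamily (~: X)) =
   \sum_(b : (size s).-tuple bool) F (mask b s) (mask (map negb b) s))%R.
Proof.
pose tup (X : {set 'I_(size s)}) := [tuple i \in X | i < size s].
rewrite (reindex tup) /=; last first.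
  exists (fun b => [set i | tnth b i]) => [X|b] _.
    by apply/setP=> i; rewrite inE tnth_mktuple.
  by apply: eq_from_tnth => i; rewrite tnth_mktuple inE.
apply: eq_bigr => X _; rewrite !subfamily_mask; congr (F _ (mask _ _)) => /=.
by rewrite -map_comp; apply: eq_map => i; rewrite /= inE.
Qed.

Lemma sum_subfamily_rev_map (V : nmodType) (A B : Type) (h : A -> B) (s : seq A)
    (F : seq B -> seq B -> V) :
  (\sum_(X : {set 'I_(size (rev (map h s)))}) F (subfamily X) (subfamily (~: X)) =
   \sum_(X : {set 'I_(size s)})
      F (rev (map h (subfamily X))) (rev (map h (subfamily (~: X)))))%R.
Proof.
rewrite sum_subfamily.
rewrite (sum_tuple_rev_map h s (fun b => F (mask b _) (mask (map negb b) _))).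
rewrite (sum_subfamily s (fun s1 s2 => F (rev (map h s1)) (rev (map h s2)))).
by apply: eq_bigr => b _; rewrite map_rev -!rev_mask ?map_mask // !size_map size_tuple.
Qed.

(** Ranks depend only on the entries and not on their order, and [alpha] commutes with relabelling;
    the remaining reversal only permutes disjoint cycles. *)
Lemma rho_rev_alphas (f : seq htree) (std_f : standard (st 0 f)) :
  uniq (flabels f) -> rho (rev (map alpha f)) = phi_basis (StdTree std_f).
Proof.
move=> Uf; have p_f := perm_rev_alphas f.
have p_st := flabels_st 0 Uf.
rewrite /phi_basis /rho /degree (perm_size p_f) (perm_size p_st) size_iota.
congr Tagged; symmetry; apply: perm_of_strings_perm.
  exact: perm_trans (perm_alphas _) p_st.
rewrite map_rev perm_sym perm_rev /st -!map_comp /=.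
have -> // : [seq [seq rank (flatten (rev (map alpha f))) a | a <- alpha t] | t <- f] =
  [seq alpha (relabel (fun j => rank (flabels f) j + 0) t) | t <- f].
apply: eq_map => t /=; rewrite alpha_relabel; apply: eq_map => j.
by rewrite addn0 (rank_perm_eq p_f).
Qed.

(** * Linear extensions from a basis *)

Section LinearExtensions.

Variable k : fieldType.

Local Open Scope ring_scope.

HB.instance Definition _ (I : choiceType) (M : lmodType k) (f : I -> M) :=
  GRing.isZmodMorphism.Build {freeg I / k} M (fglift f) (lift_is_additive f).

Lemma fgliftE (I : choiceType) (M : lmodType k) (f : I -> M) (x : {freeg I / k}) :
  fglift f x = \sum_(i <- dom x) coeff i x *: f i.
Proof.
by rewrite -{1}[x]freeg_sumE raddf_sum; apply: eq_bigr => i _; exact: liftU.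
Qed.

Lemma fglift_is_scalable (I : choiceType) (M : lmodType k) (f : I -> M) :
  scalable (fglift f).
Proof.
move=> a x; rewrite [in RHS]fgliftE scaler_sumr [LHS]raddf_sum.
by apply: eq_bigr => i _; rewrite scalerA; exact: liftU.
Qed.

HB.instance Definition _ (I : choiceType) (M : lmodType k) (f : I -> M) :=
  GRing.isScalable.Build k {freeg I / k} M *:%R (fglift f)
    (fglift_is_scalable f).

Lemma fglift1 (I : choiceType) (M : lmodType k) (f : I -> M) i :
  fglift f << i >> = f i.
Proof. by rewrite liftU scale1r. Qed.

Lemma eq_fglift (I : choiceType) (M : lmodType k) (f g : I -> M) :
  f =1 g -> fglift f =1 fglift g.
Proof. by move=> fg x; rewrite !fgliftE; apply: eq_bigr => i _; rewrite fg. Qed.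

Lemma linear_fglift (I : choiceType) (M N : lmodType k) (h : {linear M -> N})
    (f : I -> M) (x : {freeg I / k}) :
  h (fglift f x) = fglift (h \o f) x.
Proof.
rewrite !fgliftE linear_sum; apply: eq_bigr => i _; exact: linearZ.
Qed.

(** Used for inner maps that send basis vectors to basis vectors, as [phi] does. *)
Lemma fglift_fglift (I J : choiceType) (M : lmodType k) (h : J -> M) (b : I -> J)
    (x : {freeg I / k}) :
  fglift h (fglift (fun i => << b i >> : {freeg J / k}) x) = fglift (h \o b) x.
Proof.
rewrite [LHS](linear_fglift (fglift h)).
by apply: eq_fglift => i /=; apply: fglift1.
Qed.

End LinearExtensions.

(** * Compatibility of [phi] with products, coproducts and counits *)

Section BialgebraMorphism.

Variable k : fieldType.
Local Open Scope ring_scope.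

Lemma phi1 (t : stdtree) :
  phi (<< t >> : {freeg stdtree / k}) = << phi_basis t >>.
Proof. exact: fglift1. Qed.

Lemma phi_prodT_basis (t1 t2 : stdtree) :
  phi (prodT_basis k t1 t2) = heapprod_basis k (phi_basis t1) (phi_basis t2).
Proof.
rewrite /phi /prodT_basis linear_sum /heapprod_basis !strings_phi_basis /=.
have -> : [seq [seq (degree t2 + a)%N | a <- s] | s <- rev (map alpha t1)] =
    rev (map alpha (st (degree t2) t1)).
  rewrite st_shift map_rev -!map_comp; congr rev.
  by apply: eq_map => u /=; rewrite alpha_relabel.
(* Reindexing by reversed assignments brings each summand into the form given by
   [phi_basis_attach]. *)
rewrite (sum_tuple_rev_map alpha (st (degree t2) t1)
  (fun g => << Tagged (fun l => 'S_l) (perm_of_strings (degree t1 + degree t2)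
     (insert_strings (assigned (rev (map alpha (st (degree t2) t1))) g) _)) >>)).
by apply: eq_bigr => g _; rewrite fglift1 phi_basis_attach.
Qed.

(** Both sides are bilinear, so pairs of basis trees suffice. *)
Lemma phi_prodT (x y : {freeg stdtree / k}) :
  phi (prodT x y) = heapprod (phi x) (phi y).
Proof.
rewrite /heapprod /bilift {2}/phi fglift_fglift /phi /prodT /bilift linear_fglift.
apply: eq_fglift => t1 /=; rewrite fglift_fglift linear_fglift.
by apply: eq_fglift => t2 /=; rewrite -phi_prodT_basis.
Qed.

Lemma coprodS_basis_phi (t : stdtree) :
  coprodS_basis k (phi_basis t) = tensmap (@phi k) (@phi k) (coprodT_basis k t).
Proof.
rewrite /coprodS_basis strings_phi_basis.
rewrite (sum_subfamily_rev_map alpha t (fun s1 s2 => << (rho s1, rho s2) >>)).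
rewrite /tensmap /coprodT_basis linear_sum; apply: eq_bigr => X _.
rewrite /= fglift1 /tens !phi1 !fglift1.
have U (Y : {set 'I_(size t)}) : uniq (flabels (subfamily Y)).
  apply: subseq_uniq (standard_uniq (valP t)).
  exact: subseq_flabels (subfamily_subseq Y).
by rewrite !(rho_rev_alphas (subfamily_standard _) (U _)).
Qed.

Lemma coprodS_phi (x : {freeg stdtree / k}) :
  coprodS (phi x) = tensmap (@phi k) (@phi k) (coprodT x).
Proof.
rewrite /coprodS /coprodT /phi fglift_fglift [RHS]linear_fglift.
by apply: eq_fglift => t; apply: coprodS_basis_phi.
Qed.

(** It reconciles the two counits: one tests the size of a permutation, the other equality with the
    empty tree. *)
Lemma degree_eq0 (t : stdtree) : (degree t == 0)%N = (t == emptytree).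
Proof. by rewrite -val_eqE /=; case: t => -[|[a cs] f]. Qed.

Lemma counitS_phi (x : {freeg stdtree / k}) : counitS (phi x) = counitT x.
Proof.
rewrite /counitS /counitT /phi fglift_fglift.
(* The counits take values in [k] viewed as a module over itself, hence [k^o]. *)
by apply: (@eq_fglift _ _ k^o) => t; rewrite -degree_eq0.
Qed.

End BialgebraMorphism.

Theorem theorem11 (k : fieldType) :
  [/\ linear (@phi k),
      @phi k (unitT k) = unitS k,
      forall x y : kT k, @phi k (prodT x y) = heapprod (phi x) (phi y),
      forall x : kT k, coprodS (phi x) = tensmap (@phi k) (@phi k) (coprodT x)
    & forall x : kT k, counitS (phi x) = counitT x].
Proof.
split.
- exact: linearP.
(* The empty tree has degree 0 and no branches, so its image is the empty product of cycles. *)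
- by rewrite /unitT phi1 /phi_basis /perm_of_strings big_nil.
- exact: phi_prodT.
- exact: coprodS_phi.
- exact: counitS_phi.
Qed.
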